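(* Let $M$ be a nonempty set, let $\mathcal{S}$ be any family of subsets of $M$ that is closed under finite unions (a semilattice whose semigroup operation is set-theoretical union) with $\varnothing\in\mathcal{S}$, and let $\Phi:\mathcal{S}\to\mathbb{R}_+$ be a function. For every finite $X\subseteq M$ let $f(X):=\widetilde{\mu_\Phi}(\psi_X)$ be the Laplace transform of the measure $\mu_\Phi$ at $\psi_X$. Then for every $\mathcal{A}\in\mathfrak{R}$ $$\mu_\Phi(\mathcal{A})=\sum_{A\in\mathcal{A}}\ \sum_{X\subseteq A}(-1)^{|A|+|X|}f(X).$$
   Context: $\mathbb{R}_+=[0,\infty)$, and $|A|$ is the number of elements of a finite set $A$. The inner sum runs over all subsets $X$ of $A$ (including $\varnothing$ and $A$), not only those belonging to $\mathcal{S}$. The ring $\mathfrak{R}$ of subsets of $\mathcal{S}$ is $$\mathfrak{R}:=\Big\{\mathcal{A}\subseteq\mathcal{S}:\ \text{every member of }\mathcal{A}\text{ is a finite set and }\sum_{A\in\mathcal{A}}\Phi(A)<\infty\Big\}.$$ The measure $\mu_\Phi$ is given on $\mathfrak{R}$ by $\mu_\Phi(\mathcal{A}):=\sum_{A\in\mathcal{A}}\Phi(A)$ (and extended to the $\sigma$-ring generated by $\mathfrak{R}$). For $X\subseteq M$ the function $\psi_X:\mathcal{S}\to\{0,1\}$ is defined by $\psi_X(A)=1$ if $A\subseteq X$ and $\psi_X(A)=0$ otherwise. The Laplace transform of a measure $\mu$ on the (discrete) semilattice $\mathcal{S}$ is $\widetilde{\mu}(\psi)=\int_{\mathcal{S}}\psi\,d\mu$;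 for $\psi=\psi_X$ it equals $\mu(\{A\in\mathcal{S}:\psi_X(A)=1\})$. Thus for finite $X\subseteq M$, $$\widetilde{\mu_\Phi}(\psi_X)=\mu_\Phi(\{A\in\mathcal{S}:A\subseteq X\})=\sum_{A\in\mathcal{S},\,A\subseteq X}\Phi(A).$$ *)

(* Defs.v *)
From HB Require Import structures.
From mathcomp Require Import all_boot all_order all_algebra finmap.
From mathcomp Require Import all_classical all_reals all_analysis.
Set Implicit Arguments.
Unset Strict Implicit.
Unset Printing Implicit Defensive.
Import Order.TTheory GRing.Theory Num.Theory.
Import numFieldNormedType.Exports.

Local Open Scope classical_set_scope.
Local Open Scope ring_scope.
Local Open Scope ereal_scope.

Record union_semilattice (M : Type) := UnionSemilattice {
  members : set (set M) ;
  members_set0 : members set0 ;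
  members_setU : setU_closed members }.

Section semilattice.
Context (M : Type) (S : union_semilattice M).

Definition slat : Type := set_type (members S).

Definition slat_val (A : slat) : set M := val A.

HB.instance Definition _ := Choice.on slat.

Definition slat_set0 : slat := exist _ set0 (mem_set (members_set0 S)).

HB.instance Definition _ := isPointed.Build slat slat_set0.

HB.instance Definition _ := @isMeasurable.Build default_measure_display
  slat (@discrete_measurable slat) (@discrete_measurable0 slat)
  (@discrete_measurableC slat) (@discrete_measurableU slat).

End semilattice.

Coercion slat : union_semilattice >-> Sortclass.
Coercion slat_val : slat >-> set.

(* The sum of an arbitrary family of extended reals, of any sign.  As [esum]
   is meant for nonnegative terms only, positive and negative parts are summed
   separately; a finite value amounts to absolute convergence. *)
Definition signed_esum (R : realType) (T : choiceType) (D : set T)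
    (a : T -> \bar R) : \bar R :=
  \esum_(t in D) a^\+ t - \esum_(t in D) a^\- t.

Section mu_Phi.
Context (R : realType) (M : Type) (S : union_semilattice M).
Variable Phi : S -> {nonneg R}.

Definition ringR : set (set S) :=
  [set AA | (forall A : S, AA A -> finite_set (A : set M)) /\
            \esum_(A in AA) ((Phi A)%:num)%:E < +oo].

(* The sum makes sense for every subset of [S] and so defines a measure on the
   whole power set of [S], which restricts to the extension of the measure on
   [ringR] to the generated sigma-ring. *)
Definition mu_Phi (AA : set S) : \bar R := \esum_(A in AA) ((Phi A)%:num)%:E.

Let mu_Phi0 : mu_Phi set0 = 0.
Proof. exact: esum_set0. Qed.

Let mu_Phi_ge0 AA : 0 <= mu_Phi AA.
Proof. by apply: esum_ge0 => A _; rewrite lee_fin. Qed.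

Let mu_Phi_sigma_additive : semi_sigma_additive mu_Phi.
Proof.
move=> F mF tF mUF; rewrite /mu_Phi.
have Phi_ge0 (A : S) : 0 <= ((Phi A)%:num)%:E by rewrite lee_fin.
rewrite esum_bigcupT// -nneseries_esumT => [|n]; last exact: mu_Phi_ge0.
by apply: is_cvg_ereal_nneg_natsum => n _; exact: mu_Phi_ge0.
Qed.

HB.instance Definition _ := isMeasure.Build _ _ _ mu_Phi
  mu_Phi0 mu_Phi_ge0 mu_Phi_sigma_additive.

End mu_Phi.

Definition psi (R : realType) (M : Type) (S : union_semilattice M)
  (X : set M) : S -> R := \1_[set A : S | (A : set M) `<=` X].
Arguments psi R {M} S X _.

Definition laplace (R : realType) (M : Type) (S : union_semilattice M)
    (mu : {measure set S -> \bar R}) (h : S -> R) : \bar R :=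
  \int[mu]_A (h A)%:E.

(* Main.v *)
Require Import Defs.
From mathcomp Require Import all_boot all_order all_algebra finmap.
From mathcomp Require Import all_classical all_reals all_analysis.

Import Order.TTheory GRing.Theory Num.Theory.

(** For finite [X] only finitely many members of the semilattice lie in [X], so
    the Laplace transform [f X] is a finite sum of values of [Phi]
    ([laplace_mu_Phi_psi]). Moebius inversion over the subsets of a finite member [A] then
    recovers [Phi A] from the values [f X] with [X] included in [A]
    ([mobius_inversion]). Indeed, once the two sums are exchanged, [Phi B] gets
    as coefficient the alternating number of sets between [B] and [A]. This is
    [1] if [B] is [A]; otherwise it vanishes, because adding or removing some
    point of [A] chosen outside [B] pairs these sets with opposite signs
    ([alternating_sum_interval]).

    So the inner sum is [Phi A >= 0] for every [A] in the family: the negative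
    part of the outer sum vanishes and the positive part is [mu_Phi]. *)

Local Open Scope classical_set_scope.
Local Open Scope ring_scope.

Lemma finite_subsets (M : choiceType) (A : set M) :
  finite_set A -> finite_set [set X : set M | X `<=` A].
Proof.
move=> finA.
apply: (@sub_finite_set _ _
  ((fun F : {fset M} => [set` F]) @` [set` fpowerset (fset_set A)])).
  move=> X /= XA; have finX := sub_finite_set XA finA.
  exists (fset_set X); last exact: fset_setK.
  by rewrite /= fpowersetE -fset_set_sub.
exact/finite_image/finite_fset.
Qed.

(** The map [X |-> X `+` [set x]] toggles the membership of [x]: it either adds
    or removes exactly one element. *)
Lemma odd_card_setY1 (M : choiceType) (X : set M) (x : M) : finite_set X ->
  odd #|` fset_set (X `+` [set x])| = ~~ odd #|` fset_set X|.
Proof.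
move=> finX; have [xX|xX] := pselect (X x).
  have -> : X `+` [set x] = X `\ x.
    by rewrite /setY [[set x] `\` X](_ : _ = set0) ?setU0//; apply/seteqP; split=> y //= [->].
  rewrite fset_setD1// [in RHS](cardfsD1 x) in_fset_set// mem_set//=.
  by rewrite negbK.
have -> : X `+` [set x] = x |` X.
  rewrite /setY setUC; congr (_ `|` _).
    by apply/seteqP; split=> y //= [] // ->.
  by apply/seteqP; split=> y //= => [[]//|Xy]; split=> // yx; apply: xX; rewrite -yx.
by rewrite fset_setU1// cardfsU1 in_fset_set// memNset.
Qed.

(** With [x] in [A] but not in [B], the involution [X |-> X `+` [set x]] preserves
    the interval between [B] and [A] and reverses the sign of every term, so
    the sum is its own opposite. *)
Lemma alternating_sum_interval (R : numDomainType) (M : choiceType)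
    (A B : set M) : finite_set A -> B `<=` A -> B != A ->
  \sum_(X \in [set X : set M | X `<=` A] `&` [set X | B `<=` X])
    (-1 : R) ^+ #|` fset_set X| = (0 : R).
Proof.
move=> finA BA /eqP BneA.
have [x Ax nBx] : exists2 x, A x & ~ B x.
  apply: contrapT => H; apply: BneA; apply/seteqP; split=> // x Ax.
  by apply: contrapT => nBx; apply: H; exists x.
pose I := [set X | X `<=` A] `&` [set X | B `<=` X].
pose t (X : set M) := X `+` [set x].
have tK : involutive t by move=> X; rewrite /t -setYA setYK setY0.
have tI X : I X -> I (t X).
  move=> [XA BX]; split=> y /=.
    by rewrite /t /setY => -[[/XA]|[->]].
  by move=> By; left; split; [exact: BX|move=> /= yx; apply: nBx; rewrite -yx].
have tbij : set_bij I I t.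
  split.
  - by move=> X; exact: tI.
  - by move=> X Y _ _; exact: (inv_inj tK).
  - by move=> X IX; exists (t X); [exact: tI|exact: tK].
apply/eqP; rewrite -eqNr; apply/eqP; rewrite -/I.
rewrite [RHS](reindex_fsbig t I I)// -[LHS]mulN1r mulr_fsumr.
apply: eq_fsbigr => X /set_mem[XA _].
rewrite -[in RHS]signr_odd odd_card_setY1; last exact: sub_finite_set finA.
by rewrite signrN signr_odd mulN1r.
Qed.

(** The index family [E] lets the sum run over the members of a semilattice
    rather than over all subsets; injectivity
    leaves [i] as the only index with the full set [E i]. *)
Lemma mobius_inversion (R : numDomainType) (M I : choiceType)
    (E : I -> set M) (w : I -> R) (i : I) : injective E -> finite_set (E i) ->
  \sum_(X \in [set X : set M | X `<=` E i])
    (-1) ^+ (#|` fset_set (E i)| + #|` fset_set X|) *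
    \sum_(j \in [set j | E j `<=` X]) w j = w i.
Proof.
move=> injE finEi.
pose P := [set j | E j `<=` E i].
have finX := finite_subsets _ _ finEi.
have finP : finite_set P by apply: finite_preimage finX => ? ? _ _; exact: injE.
pose s (X : set M) : R := (-1) ^+ (#|` fset_set (E i)| + #|` fset_set X|).
(* Making the index set of the inner sum independent of [X] allows the two
   sums to be exchanged. *)
transitivity (\sum_(X \in [set X | X `<=` E i]) \sum_(j \in P)
    (if X \in [set X | E j `<=` X] then w j * s X else 0)).
  apply: eq_fsbigr => X /set_mem/= XEi.
  have -> : [set j | E j `<=` X] = P `&` [set j | E j `<=` X].
    by apply/seteqP; split=> j /= => [jX|[]//]; split=> //; exact: subset_trans XEi.
  rewrite mulr_fsumr fsbig_mkcondr; apply: eq_fsbigr => j _.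
  by rewrite mulrC.
rewrite exchange_fsbig//.
under eq_fsbigr do rewrite -fsbig_mkcondr -mulr_fsumr.
rewrite (fsbigD1 i)//=.
rewrite [X in _ + X]fsbig1 ?addr0.
  rewrite [X in _ * X](_ : _ = 1) ?mulr1//.
  have -> : [set X | X `<=` E i] `&` [set X | E i `<=` X] = [set E i].
    by apply/seteqP; split=> X /= => [[? ?]|->//]; exact/seteqP.
  by rewrite fsbig_set1 /s addnn -signr_odd odd_double.
move=> j [jP /= ji].
under eq_fsbigr do rewrite /s exprD.
rewrite -mulr_fsumr alternating_sum_interval ?mulr0//.
by apply/eqP => /injE.
Qed.

Local Open Scope ereal_scope.

(** The integral of the indicator [psi R S X] is the mass of the members of [S]
    included in [X]; as they are finitely many, it is a real number, which
    brings the inversion formula back to real coefficients. *)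
Lemma laplace_mu_Phi_psi (R : realType) (M : choiceType)
    (S : union_semilattice M) (Phi : S -> {nonneg R}) (X : set M) :
  finite_set X ->
  laplace (mu_Phi Phi) (psi R S X) =
  (\sum_(B \in [set B : S | (B : set M) `<=` X]) (Phi B)%:num)%:E.
Proof.
move=> finX; rewrite /laplace /psi integral_indic// setIT.
have finS : finite_set [set B : S | (B : set M) `<=` X].
  apply: (@finite_preimage _ _ [set Y | Y `<=` X] (@slat_val M S)).
    by move=> ? ? _ _; exact: val_inj.
  exact: finite_subsets.
by rewrite /= /mu_Phi esum_fset// fsumEFin.
Qed.

Theorem theorem4 (R : realType) (M : choiceType) (M_neq0 : [set: M] !=set0)
    (S : union_semilattice M) (Phi : S -> {nonneg R}) :
  let f (X : set M) : \bar R := laplace (mu_Phi Phi) (psi R S X) in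
  forall AA : set S, ringR Phi AA ->
    mu_Phi Phi AA =
    signed_esum AA (fun A : S =>
      \sum_(X \in [set X : set M | X `<=` A])
        ((-1) ^+ (#|` fset_set (A : set M)| + #|` fset_set X|))%:E * f X).
Proof.
move=> f AA [finAA _].
pose g (A : S) := \sum_(X \in [set X : set M | X `<=` A])
  ((-1) ^+ (#|` fset_set (A : set M)| + #|` fset_set X|))%:E * f X.
have gE A : AA A -> g A = ((Phi A)%:num)%:E.
  move=> /finAA finA.
  rewrite -(mobius_inversion _ _ _ (@slat_val M S) (fun B : S => (Phi B)%:num)) //.
  rewrite -fsumEFin; last exact: finite_subsets.
  apply: eq_fsbigr => X /set_mem/= XA.
  by rewrite /f laplace_mu_Phi_psi// ; exact: sub_finite_set finA.
have g_ge0 A : AA A -> 0 <= g A by move=> /gE ->; rewrite lee_fin.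
rewrite /signed_esum -/g [X in _ - X]esum1 ?sube0 => [|A AAA].
  apply: eq_esum => A AAA.
  by rewrite (ge0_funeposE g_ge0) ?inE ?gE.
by rewrite (ge0_funenegE g_ge0) ?inE.
Qed.
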